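(* Let $n > 1$ be an integer, let $j = 2n-1$, and let $N = n^2 + j = n^2+2n-1$. Then the length of the period of the continued fraction of $\sqrt{N}$ is $4$ and $\sqrt{N} = [n, \overline{1, n-1, 1, 2n}]$.
   Context: The (simple) continued fraction expansion of an irrational real number $x$ is the unique infinite sequence $[a_0,a_1,a_2,\dots]$ with $a_0\in\mathbb Z$ and $a_i$ a positive integer for $i\ge 1$, such that the convergents $a_0+\cfrac{1}{a_1+\cfrac{1}{\ddots+\cfrac{1}{a_m}}}$ converge to $x$ as $m\to\infty$. The notation $[a_0,\dots,a_k,\overline{a_{k+1},\dots,a_\ell}]$ means that the block $a_{k+1},\dots,a_\ell$ is repeated infinitely many times after the preperiod $a_0,\dots,a_k$. The length of the period is the number of entries in the shortest repeating block. *)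

(* Defs.v *)
From Stdlib Require Import Reals ZArith List.
Open Scope Z_scope.

Definition irrational (x : R) : Prop :=
  forall p q : Z, q <> 0 -> x <> (IZR p / IZR q)%R.

(* [cf_convergent a m] is a_0 + 1/(a_1 + 1/(... + 1/a_m)).  No division by zero
   occurs when a_i >= 1 for all i >= 1. *)
Fixpoint cf_convergent (a : nat -> Z) (m : nat) : R :=
  match m with
  | O => IZR (a O)
  | S m' => (IZR (a O) + / cf_convergent (fun i => a (S i)) m')%R
  end.

Definition cf_converges_to (x : R) (a : nat -> Z) : Prop :=
  (forall i : nat, (1 <= i)%nat -> 0 < a i) /\ Un_cv (cf_convergent a) x.

Definition cf_expansion (x : R) (a : nat -> Z) : Prop :=
  irrational x /\ unique (cf_converges_to x) a.

(* The sequence [pre, \overline{per}], for a nonempty block [per]. *)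
Definition periodic_seq (pre per : list Z) (i : nat) : Z :=
  if (i <? length pre)%nat then nth i pre 0
  else nth ((i - length pre) mod length per) per 0.

(* [a] has the form [pre, \overline{per}] with [per] of length [l]. *)
Definition repeating_block_length (a : nat -> Z) (l : nat) : Prop :=
  exists pre per : list Z,
    length per = l /\ per <> nil /\ forall i : nat, a i = periodic_seq pre per i.

Definition cf_period_length (x : R) (l : nat) : Prop :=
  exists a : nat -> Z,
    cf_expansion x a /\
    repeating_block_length a l /\
    forall l' : nat, repeating_block_length a l' -> (l <= l')%nat.

(* Main.v *)
(** The complete quotients of [sqrt N] are quadratic surds that return to their
    starting value after four steps; any sequence of complete quotients that are
    at least 1 forces convergence, because two consecutive inversion steps
    contract distances by a factor 4.  Uniqueness holds because the first partial
    quotient of an irrational number is its integer part.  The period cannot be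
    shorter since [2 * n] occurs exactly at the positive multiples of 4.  Finally
    [n < sqrt N < n + 1], so a fraction [p / q] equal to [sqrt N] could be
    replaced by [(N q - n p) / (p - n q)], of smaller denominator. *)

Require Import Defs.
From Stdlib Require Import Reals ZArith List.
From Stdlib Require Import Lra Lia ZifyNat FunctionalExtensionality.
Import ListNotations.
Open Scope Z_scope.

Ltac Zify.zify_post_hook ::= Z.to_euclidean_division_equations.

(** Keeps irrationality when passing from a number to its next complete quotient, as the induction
    for uniqueness requires. *)
Lemma irrational_sub_inv (x : R) (a : Z) :
  irrational x -> irrational (/ (x - IZR a)).
Proof.
  intros Hx p q Hq E.
  assert (Hxa : (x - IZR a)%R <> 0%R).
  { intro H. apply (Hx a 1); [lia | lra]. }
  assert (Hq' : IZR q <> 0%R) by (apply not_0_IZR; exact Hq).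
  assert (Hp : p <> 0).
  { intros ->. apply (Rinv_neq_0_compat _ Hxa). rewrite E. field. exact Hq'. }
  assert (Hp' : IZR p <> 0%R) by (apply not_0_IZR; exact Hp).
  apply (Hx (a * p + q) p Hp).
  rewrite plus_IZR, mult_IZR.
  assert (E' : (x - IZR a)%R = (IZR q / IZR p)%R).
  { rewrite <- (Rinv_inv (x - IZR a)), E. field. split; assumption. }
  replace x with ((x - IZR a) + IZR a)%R by ring.
  rewrite E'. field. exact Hp'.
Qed.

Lemma no_square_between (m N p q : Z) :
  0 <= m -> m ^ 2 < N < (m + 1) ^ 2 -> 0 < q -> 0 <= p -> p * p <> N * (q * q).
Proof.
  intros Hm HN Hq. assert (Hq0 : 0 <= q) by lia. revert p Hq.
  pattern q. revert q Hq0. apply Zlt_0_ind.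
  intros q IH _ p Hq Hp E.
  assert (H1 : m * q < p) by nia.
  assert (H2 : p < (m + 1) * q) by nia.
  (* The new pair solves the same equation because [(N q - m p)^2 - N (p - m q)^2 = (m^2 - N) (p^2 -
     N q^2)], and the two bounds give [0 < p - m q < q]. *)
  apply (IH (p - m * q)) with (p := N * q - m * p); nia.
Qed.

Lemma irrational_sqrt_between (m N : Z) :
  0 <= m -> m ^ 2 < N < (m + 1) ^ 2 -> irrational (sqrt (IZR N)).
Proof.
  intros Hm HN p q Hq E.
  assert (Hq' : IZR q <> 0%R) by (apply not_0_IZR; exact Hq).
  apply (no_square_between m N (Z.abs p) (Z.abs q)); try lia.
  assert (H : p * p = N * (q * q)); [| nia].
  apply eq_IZR. rewrite !mult_IZR.
  assert (HR : (0 <= IZR N)%R) by (apply IZR_le; nia).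
  rewrite <- (sqrt_sqrt _ HR), E. field. exact Hq'.
Qed.

Lemma cf_convergent_ge_1 (a : nat -> Z) (m : nat) :
  (forall i, 0 < a i) -> (1 <= cf_convergent a m)%R.
Proof.
  revert a. induction m as [|m IH]; intros a Ha; simpl;
    assert (H0 : (1 <= IZR (a 0%nat))%R) by (apply IZR_le; specialize (Ha 0%nat); lia).
  - exact H0.
  - specialize (IH (fun i => a (S i)) (fun i => Ha (S i))).
    assert (0 < / cf_convergent (fun i => a (S i)) m)%R by (apply Rinv_0_lt_compat; lra).
    lra.
Qed.

(** The tail has positive terms, so its convergents are at least 1 and their inverses lie in (0, 1].
    These inverses tend to [x - a 0], which irrationality keeps away from 0 and 1; continuity of
    inversion then gives the limit of the tail. *)
Lemma cf_converges_to_step (x : R) (a : nat -> Z) :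
  irrational x -> cf_converges_to x a ->
  (IZR (a O) < x < IZR (a O) + 1)%R /\
  cf_converges_to (/ (x - IZR (a O))) (fun i => a (S i)).
Proof.
  intros Hx [Ha Hcv].
  set (b := fun i => a (S i)).
  assert (Hb : forall m, (1 <= cf_convergent b m)%R).
  { intro m. apply cf_convergent_ge_1. intro i. apply Ha. lia. }
  assert (Hinv : Un_cv (fun m => / cf_convergent b m)%R (x - IZR (a O))).
  { intros eps Heps. destruct (Hcv eps Heps) as [M HM]. exists M. intros m Hm.
    specialize (HM (S m) ltac:(lia)). unfold Rdist in *. simpl in HM. fold b in HM.
    replace (/ cf_convergent b m - (x - IZR (a 0%nat)))%R
      with (IZR (a 0%nat) + / cf_convergent b m - x)%R by ring.
    exact HM. }
  assert (Hne : (x - IZR (a O))%R <> 0%R).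
  { intro H. apply (Hx (a O) 1); [lia | lra]. }
  assert (Hne1 : (x - IZR (a O))%R <> 1%R).
  { intro H. apply (Hx (a O + 1) 1); [lia | rewrite plus_IZR; lra]. }
  assert (Hbounds : forall m, (0 < / cf_convergent b m <= 1)%R).
  { intro m. specialize (Hb m). split; [apply Rinv_0_lt_compat; lra |].
    rewrite <- Rinv_1. apply Rinv_le_contravar; lra. }
  assert (Hge : (0 <= x - IZR (a O))%R).
  { apply Rnot_lt_le. intro Hlt.
    (* Here [eps] is the distance from the supposed limit to [0, 1], so a late term would leave the
       interval as well. *)
    destruct (Hinv (- (x - IZR (a O)))%R ltac:(lra)) as [M HM].
    specialize (HM M ltac:(lia)). apply Rabs_def2 in HM. specialize (Hbounds M). lra. }
  assert (Hle : (x - IZR (a O) <= 1)%R).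
  { apply Rnot_lt_le. intro Hlt.
    destruct (Hinv (x - IZR (a O) - 1)%R ltac:(lra)) as [M HM].
    specialize (HM M ltac:(lia)). apply Rabs_def2 in HM. specialize (Hbounds M). lra. }
  split; [lra |]. split.
  - intros i Hi. apply Ha. lia.
  - apply Un_cv_ext with (fun m => / / cf_convergent b m)%R.
    { intro m. apply Rinv_inv. }
    apply (continuity_seq (fun y => / y)%R (fun m => / cf_convergent b m)%R); [| exact Hinv].
    apply (continuity_pt_inv (fun y => y)); [| exact Hne].
    apply derivable_continuous_pt, derivable_pt_id.
Qed.

Lemma cf_converges_to_nth_unique (m : nat) (x : R) (a b : nat -> Z) :
  irrational x -> cf_converges_to x a -> cf_converges_to x b -> a m = b m.
Proof.
  revert x a b. induction m as [|m IH]; intros x a b Hx Hxa Hxb;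
    destruct (cf_converges_to_step x a Hx Hxa) as [Ha Ha'];
    destruct (cf_converges_to_step x b Hx Hxb) as [Hb Hb'];
    assert (E : a O = b O) by
      (assert (IZR (a O) < IZR (b O + 1))%R by (rewrite plus_IZR; lra);
       assert (IZR (b O) < IZR (a O + 1))%R by (rewrite plus_IZR; lra);
       apply Z.le_antisymm; apply Z.lt_succ_r; apply lt_IZR; assumption).
  - exact E.
  - rewrite <- E in Hb'.
    exact (IH _ _ _ (irrational_sub_inv x (a O) Hx) Ha' Hb').
Qed.

Lemma cf_expansion_of_converges (x : R) (a : nat -> Z) :
  irrational x -> cf_converges_to x a -> cf_expansion x a.
Proof.
  intros Hx Ha. split; [exact Hx |]. split; [exact Ha |].
  intros b Hb. apply functional_extensionality. intro m.
  exact (cf_converges_to_nth_unique m x a b Hx Ha Hb).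
Qed.

(* As [u = a + / u'], the product [u u' = a u' + 1] is at least 2, and likewise
   [v v' >= 2]. *)
Lemma inv_two_step_contraction (a u' v' : R) :
  (1 <= a)%R -> (1 <= u')%R -> (1 <= v')%R ->
  (Rabs (/ (a + / u') - / (a + / v')) <= Rabs (u' - v') / 4)%R.
Proof.
  intros Ha Hu Hv.
  replace (/ (a + / u') - / (a + / v'))%R
    with ((u' - v') * / ((a * u' + 1) * (a * v' + 1)))%R
    by (field; repeat split; nra).
  assert (Hden : (4 <= (a * u' + 1) * (a * v' + 1))%R).
  { assert (2 <= a * u' + 1)%R by nra. assert (2 <= a * v' + 1)%R by nra. nra. }
  rewrite Rabs_mult, (Rabs_pos_eq (/ _)) by (apply Rlt_le, Rinv_0_lt_compat; lra).
  apply Rmult_le_compat_l; [apply Rabs_pos |].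
  apply Rinv_le_contravar; lra.
Qed.

(** Induction in steps of two, since a single inversion need not contract by a fixed factor near 1.
    The factor 2 absorbs the error at [m = 1], which is only bounded by 1; each double step then
    divides by 4. *)
Lemma cf_convergent_error (m : nat) (a : nat -> Z) (x : nat -> R) :
  (forall i, (1 <= i)%nat -> 0 < a i) ->
  (forall i, (1 <= i)%nat -> (1 <= x i)%R) ->
  (forall i, x i = (IZR (a i) + / x (S i))%R) ->
  (Rabs (cf_convergent a m - x O) <= 2 * (/ 2) ^ m)%R.
Proof.
  revert a x.
  induction m as [m IH] using lt_wf_ind. intros a x Ha Hx Hrec.
  assert (Hainv : forall i, (0 < / x (S i) <= 1)%R).
  { intro i. specialize (Hx (S i) ltac:(lia)). split; [apply Rinv_0_lt_compat; lra |].
    rewrite <- Rinv_1. apply Rinv_le_contravar; lra. }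
  assert (Ha1 : (1 <= IZR (a 1%nat))%R).
  { apply IZR_le. specialize (Ha 1%nat ltac:(lia)). lia. }
  destruct m as [|[|m]].
  - simpl. rewrite (Hrec O). specialize (Hainv O).
    apply Rabs_le. lra.
  - simpl. rewrite (Hrec O). pose proof (Hainv O) as H0.
    assert (0 < / IZR (a 1%nat) <= 1)%R.
    { split; [apply Rinv_0_lt_compat; lra |].
      rewrite <- Rinv_1. apply Rinv_le_contravar; lra. }
    apply Rabs_le. lra.
  - specialize (IH m ltac:(lia) (fun i => a (S (S i))) (fun i => x (S (S i)))
      (fun i _ => Ha (S (S i)) ltac:(lia)) (fun i _ => Hx (S (S i)) ltac:(lia))
      (fun i => Hrec (S (S i)))).
    simpl cf_convergent. rewrite (Hrec O), (Hrec 1%nat).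
    pose proof (cf_convergent_ge_1 (fun i => a (S (S i))) m
      (fun i => Ha (S (S i)) ltac:(lia))) as Hu.
    pose proof (inv_two_step_contraction (IZR (a 1%nat)) _ _ Ha1 Hu
      (Hx 2%nat ltac:(lia))) as Hc.
    (* The common term [a 0] cancels, leaving the difference bounded in [Hc]. *)
    match goal with |- (Rabs ?e <= _)%R =>
      match type of Hc with (Rabs ?f <= _)%R => replace e with f by ring end end.
    simpl pow. lra.
Qed.

Lemma cf_converges_to_complete_quotients (a : nat -> Z) (x : nat -> R) :
  (forall i, (1 <= i)%nat -> 0 < a i) ->
  (forall i, (1 <= i)%nat -> (1 <= x i)%R) ->
  (forall i, x i = (IZR (a i) + / x (S i))%R) ->
  cf_converges_to (x O) a.
Proof.
  intros Ha Hx Hrec. split; [exact Ha |]. intros eps Heps.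
  destruct (pow_lt_1_zero (/ 2) ltac:(rewrite Rabs_pos_eq; lra) (eps / 2) ltac:(lra))
    as [M HM].
  exists M. intros m Hm. specialize (HM m Hm). apply Rabs_def2 in HM.
  unfold Rdist. pose proof (cf_convergent_error m a x Ha Hx Hrec). lra.
Qed.

(** Eventual invariance under a shift by [l] is all that minimality uses; it disposes of the
    arbitrary preperiod and block. *)
Lemma repeating_block_length_shift (a : nat -> Z) (l : nat) :
  repeating_block_length a l ->
  (0 < l)%nat /\ exists k : nat, forall i, (k <= i)%nat -> a (i + l)%nat = a i.
Proof.
  intros (pre & per & Hl & Hper & Ha).
  assert (Hpos : (0 < l)%nat).
  { destruct per; [congruence | simpl in Hl; lia]. }
  split; [exact Hpos |]. exists (length pre). intros i Hi.
  rewrite !Ha. unfold periodic_seq. rewrite Hl.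
  rewrite (proj2 (Nat.ltb_ge i (length pre)) Hi).
  rewrite (proj2 (Nat.ltb_ge (i + l) (length pre)) ltac:(lia)).
  replace (i + l - length pre)%nat with (i - length pre + 1 * l)%nat by lia.
  rewrite Nat.Div0.mod_add. reflexivity.
Qed.

(** Couples the residues of neighbouring indices, so that one case split evaluates both a complete
    quotient and its successor. *)
Lemma mod4_S (k : nat) :
  (k mod 4 = 0 /\ S k mod 4 = 1 \/ k mod 4 = 1 /\ S k mod 4 = 2 \/
   k mod 4 = 2 /\ S k mod 4 = 3 \/ k mod 4 = 3 /\ S k mod 4 = 0)%nat.
Proof. lia. Qed.

Lemma periodic_seq_single_S (c : Z) (per : list Z) (k : nat) :
  periodic_seq [c] per (S k) = nth (k mod length per) per 0.
Proof.
  unfold periodic_seq. simpl length. change (S k <? 1)%nat with false.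
  cbv iota. rewrite Nat.sub_succ, Nat.sub_0_r. reflexivity.
Qed.

Lemma period_four_minimal (n : Z) (l : nat) :
  1 < n -> repeating_block_length (periodic_seq [n] [1; n - 1; 1; 2 * n]) l -> (4 <= l)%nat.
Proof.
  intros Hn H. apply repeating_block_length_shift in H as [Hl [k Hk]].
  (* This index is a positive multiple of 4 beyond [k], so the entry there is [2 * n]. A shift by 1,
     2 or 3 would meet [1], [n - 1] or [1] instead. *)
  specialize (Hk (S (4 * k + 3)) ltac:(lia)).
  rewrite Nat.add_succ_l in Hk.
  rewrite !periodic_seq_single_S in Hk. simpl length in Hk.
  replace ((4 * k + 3) mod 4)%nat with 3%nat in Hk by lia.
  destruct l as [|[|[|[|l]]]]; try lia.
  - replace ((4 * k + 3 + 1) mod 4)%nat with 0%nat in Hk by lia. cbn [nth] in Hk. lia.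
  - replace ((4 * k + 3 + 2) mod 4)%nat with 1%nat in Hk by lia. cbn [nth] in Hk. lia.
  - replace ((4 * k + 3 + 3) mod 4)%nat with 2%nat in Hk by lia. cbn [nth] in Hk. lia.
Qed.

Lemma one_le_Rdiv (x y : R) : (0 < y <= x -> 1 <= x / y)%R.
Proof.
  intros H. apply (Rmult_le_reg_r y); [lra |].
  replace (x / y * y)%R with x by (field; lra). lra.
Qed.

(** For [s = sqrt N] these are the surds [(s + P) / Q] of the classical algorithm: successive
    denominators multiply to [N - n^2 = 2 n - 1] or to [N - (n - 1)^2 = 2 (2 n - 1)]. *)
Definition sqrt_complete_quotient (n : Z) (s : R) (i : nat) : R :=
  match i with
  | O => s
  | S k =>
      nth (k mod 4)
        [(s + IZR n) / (2 * IZR n - 1); (s + IZR n - 1) / 2;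
         (s + IZR n - 1) / (2 * IZR n - 1); s + IZR n]%R 0%R
  end.

Lemma period_four_converges (n : Z) (s : R) :
  1 < n -> (0 <= s)%R -> (s * s = IZR n * IZR n + 2 * IZR n - 1)%R ->
  cf_converges_to s (periodic_seq [n] [1; n - 1; 1; 2 * n]).
Proof.
  intros Hn Hs0 Hs.
  assert (HnR : (2 <= IZR n)%R) by (apply IZR_le; lia).
  (* With [n >= 2], this bound puts every complete quotient above 1. *)
  assert (Hsn : (IZR n < s)%R) by nra.
  apply (cf_converges_to_complete_quotients _ (sqrt_complete_quotient n s)).
  - intros [|k] Hi; [lia |]. rewrite periodic_seq_single_S. simpl length.
    destruct (mod4_S k) as [[-> _]|[[-> _]|[[-> _]|[-> _]]]]; cbn [nth]; lia.
  - intros [|k] Hi; [lia |]. unfold sqrt_complete_quotient.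
    destruct (mod4_S k) as [[-> _]|[[-> _]|[[-> _]|[-> _]]]]; cbn [nth];
      try (apply one_le_Rdiv; lra); lra.
  - intros [|k].
    + change (periodic_seq [n] [1; n - 1; 1; 2 * n] 0) with n.
      unfold sqrt_complete_quotient. change (0 mod 4)%nat with 0%nat. cbn [nth].
      field_simplify_eq; [| lra]. lra.
    + rewrite periodic_seq_single_S. unfold sqrt_complete_quotient. simpl length.
      (* Once denominators are cleared, each of the four recurrences reduces to the quadratic
         equation [Hs]. *)
      destruct (mod4_S k) as [[-> ->]|[[-> ->]|[[-> ->]|[-> ->]]]]; cbn [nth];
        rewrite ?minus_IZR, ?mult_IZR; field_simplify_eq; lra.
Qed.

Theorem mainTheorem4 (n j N : Z) (hn : 1 < n) (hj : j = 2 * n - 1)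
    (hN : N = n ^ 2 + j) :
  cf_period_length (sqrt (IZR N)) 4 /\
  cf_expansion (sqrt (IZR N)) (periodic_seq [n] [1; n - 1; 1; 2 * n]).
Proof.
  assert (Hexp : cf_expansion (sqrt (IZR N)) (periodic_seq [n] [1; n - 1; 1; 2 * n])).
  { apply cf_expansion_of_converges.
    (* [N = (n + 1)^2 - 2] lies strictly between consecutive squares. *)
    - apply (irrational_sqrt_between n); lia.
    - apply period_four_converges; [exact hn | apply sqrt_pos |].
      rewrite sqrt_sqrt by (apply IZR_le; nia).
      replace N with (n * n + 2 * n - 1) by nia.
      rewrite minus_IZR, plus_IZR, !mult_IZR. reflexivity. }
  split; [| exact Hexp].
  exists (periodic_seq [n] [1; n - 1; 1; 2 * n]). split; [exact Hexp |]. split.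
  - exists [n], [1; n - 1; 1; 2 * n]. split; [reflexivity |]. split; [discriminate |].
    reflexivity.
  - intro l. exact (period_four_minimal n l hn).
Qed.
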